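(* Let $\alpha>0$. The square with equal masses is the unique centered co-circular central configuration for the $4$-body problem with power-law potential $U_\alpha$. That is: let $m_1,\dots,m_4>0$ and let $x_1,\dots,x_4$ be pairwise distinct points lying on a common circle whose center is the center of mass $c_0=\frac{\sum_k m_kx_k}{\sum_k m_k}$. Then $(x_1,\dots,x_4)$ is a central configuration for the masses $(m_1,\dots,m_4)$ and the potential $U_\alpha$ if and only if $m_1=m_2=m_3=m_4$ and $x_1,\dots,x_4$ are (in some order) the vertices of a square.
   Context: For $\alpha>0$, masses $m_1,\dots,m_n>0$ and pairwise distinct points $x_1,\dots,x_n\in\mathbb{R}^3$, the power-law potential is $U_\alpha(x)=\sum_{1\le j<k\le n}\frac{m_jm_k}{|x_j-x_k|^\alpha}$. The configuration $(x_1,\dots,x_n)$ is a central configuration for the masses $(m_1,\dots,m_n)$ if there is a constant $\lambda\in\mathbb{R}$ such that $$\sum_{j\ne k}\frac{x_j-x_k}{|x_j-x_k|^{\alpha+2}}m_jm_k=-\frac{\lambda}{\alpha}m_k(x_k-c_0),\qquad k=1,\dots,n,$$ where $c_0=\frac{\sum_{k}m_kx_k}{\sum_k m_k}$ is the center of mass. A central configuration is centered co-circular if all the points lie on a circle (of positive radius, in a plane) whose center is $c_0$. Central configurations are considered modulo rotations, translations and dilations. *)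

(* Defs.v *)
From HB Require Import structures.
From mathcomp Require Import all_boot all_order all_algebra all_fingroup.
From mathcomp Require Import all_reals exp.

Set Implicit Arguments.
Unset Strict Implicit.
Unset Printing Implicit Defensive.

Import Order.TTheory GRing.Theory Num.Theory.

Local Open Scope ring_scope.

Section Euclidean.
Variables (R : realType) (d : nat).
Implicit Types u v : 'rV[R]_d.

Definition dotp u v : R := \sum_(i < d) u 0 i * v 0 i.

(* The norm `|u| that MathComp-Analysis puts on 'rV[R]_d is the sup norm. *)
Definition enorm u : R := Num.sqrt (dotp u u).

End Euclidean.

Section CentralConfigurations.
Variables (R : realType) (n : nat).
Implicit Types (m : 'I_n -> R) (x : 'I_n -> 'rV[R]_3).

Definition center_of_mass m x : 'rV[R]_3 :=
  (\sum_k m k)^-1 *: \sum_k m k *: x k.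

(* The critical point equation of the potential
   \sum_(j < k) m_j m_k / |x_j - x_k|^alpha
   relative to the moment of inertia about the center of mass. *)
Definition central_configuration (alpha : R) m x : Prop :=
  exists lambda : R, forall k : 'I_n,
    \sum_(j < n | j != k)
      (m j * m k / enorm (x j - x k) `^ (alpha + 2)) *: (x j - x k) =
    - (lambda / alpha * m k) *: (x k - center_of_mass m x).

End CentralConfigurations.

Section Circle.
Variable R : realType.

(* The circle of center c and radius r in the plane through c that is
   orthogonal to nu; it is a genuine circle when nu != 0 and 0 < r. *)
Definition on_circle (c nu : 'rV[R]_3) (r : R) (p : 'rV[R]_3) : Prop :=
  dotp nu (p - c) = 0 /\ enorm (p - c) = r.

Definition centered_cocircular (n : nat) (m : 'I_n -> R)
    (x : 'I_n -> 'rV[R]_3) : Prop :=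
  exists (nu : 'rV[R]_3) (r : R), [/\ nu != 0, 0 < r &
    forall k, on_circle (center_of_mass m x) nu r (x k)].

(* a, b, c, d are the consecutive vertices of a nondegenerate square:
   a parallelogram with two equal and orthogonal adjacent sides. *)
Definition square (a b c d : 'rV[R]_3) : Prop :=
  [/\ a != b, b - a = c - d, enorm (b - a) = enorm (d - a) &
      dotp (b - a) (d - a) = 0].

Definition square_in_some_order (x : 'I_4 -> 'rV[R]_3) : Prop :=
  exists s : 'S_4,
    square (x (s (inord 0%N))) (x (s (inord 1%N)))
           (x (s (inord 2%N))) (x (s (inord 3%N))).

End Circle.

(* Main.v *)
(* Center the circle at the origin and use plane coordinates; write D i j for the
   determinant of the positions of i and j, t i j for their distance, and
   W t = t^-(alpha + 2). Pairing the force equation at k with the position of k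
   shows that \sum_j m j * t j k ^ 2 * W (t j k) does not depend on k; its
   tangential part is \sum_j m j * W (t j k) * D j k = 0. The center of mass
   condition gives the same two statements without W.

   Label the points a, b, c, d counterclockwise. The tangential equations at a and
   at c relate the sides only through D * (W t - W (t a c)), which decreases with
   t, so ab < bc if and only if da < cd. Then m b * (bc^2 - ab^2) +
   m d * (cd^2 - da^2) = (m c - m a) * ac^2 and the same identity for the
   decreasing function t^2 * W t force m a = m c; likewise m b = m d. As the
   diagonals cross, the center of mass condition then makes opposite points
   antipodal, and the remaining equations give the square and m a = m b. *)
Require Import Defs.
From mathcomp Require Import all_boot all_order all_algebra all_fingroup.
From mathcomp Require Import all_reals exp.
From mathcomp Require Import ring lra.

Set Implicit Arguments.
Unset Strict Implicit.
Unset Printing Implicit Defensive.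

Import Order.TTheory GRing.Theory Num.Theory.
Local Open Scope ring_scope.

(** * Four labels, directed 4-cycles, and a comparison of cosines *)

Lemma mem_uniq4 {a b c d : 'I_4} (i : 'I_4) :
  uniq [:: a; b; c; d] -> i \in [:: a; b; c; d].
Proof.
move=> u4; have [|_ ->] := uniq_min_size u4 (fun j _ => mem_enum 'I_4 j).
  by rewrite size_enum_ord.
by rewrite mem_enum.
Qed.

Lemma sum_ord4 (V : nmodType) (F : 'I_4 -> V) {a b c d : 'I_4} :
  uniq [:: a; b; c; d] -> \sum_i F i = F a + F b + F c + F d.
Proof.
move=> u4; have p4 : perm_eq (index_enum 'I_4) [:: a; b; c; d].
  by apply: uniq_perm => [||i]; rewrite ?index_enum_uniq // mem_index_enum mem_uniq4.
by rewrite (perm_big _ p4) !big_cons big_nil /= addr0 !addrA.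
Qed.

(** Quantification over [bool] as a computable Boolean: twelve uses of [bothP] turn the tautology
    behind the 4-cycle lemma into a closed term for [vm_compute]. *)
Definition both (P : pred bool) := P true && P false.

Lemma bothP (P : pred bool) : both P -> forall b, P b.
Proof. by case/andP=> Pt Pf []. Qed.

(* Applied to p i j := 0 < D i j; the last hypothesis then describes antipodal
   points i and j. *)
Lemma exists_directed_4cycle (p : rel 'I_4) :
  (forall i, exists j, p i j) -> (forall i, exists j, p j i) ->
  (forall i j, p i j -> ~~ p j i) ->
  (forall i j k, i != j -> ~~ p i j -> ~~ p j i -> p i k = p k j) ->
  exists a b c d, uniq [:: a; b; c; d] /\ [&& p a b, p b c, p c d & p d a].
Proof.
pose o i : 'I_4 := inord i.
have oD i j : (i < 4)%N -> (j < 4)%N -> (o i == o j) = (i == j).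
  by move=> ? ?; rewrite -val_eqE /= !inordK.
have ex4 (P : pred 'I_4) : (exists j, P j) -> [|| P (o 0), P (o 1), P (o 2) | P (o 3)].
  case=> j; have -> : j = o j by rewrite /o inord_val.
  by case: j => [[|[|[|[|//]]]]] ? /= ->; rewrite ?orbT.
move=> out inn asym anti.
have pF i : p i i = false by apply/negP => pii; have := asym _ _ pii; rewrite pii.
pose q i j := p (o i) (o j).
pose cycle4 i j k l := [&& q i j, q j k, q k l & q l i].
(* Rotation lets a cycle start at 0, which leaves the six orders of the other three labels. *)
suff : [|| cycle4 0 1 2 3, cycle4 0 1 3 2, cycle4 0 2 1 3, cycle4 0 2 3 1,
           cycle4 0 3 1 2 | cycle4 0 3 2 1]%N.
  have cyc i j k l : cycle4 i j k l -> uniq [:: i; j; k; l] ->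
      (all (fun n => n < 4) [:: i; j; k; l])%N ->
      exists a b c d, uniq [:: a; b; c; d] /\ [&& p a b, p b c, p c d & p d a].
    move=> cijkl u /= /and5P[? ? ? ? _]; exists (o i), (o j), (o k), (o l).
    by split=> //; move: u; rewrite /= !inE !oD.
  by do 5?[case/orP]; move/cyc; apply.
have A i j : ~~ (q i j && q j i).
  by apply/negP => /andP[/asym/negP].
have Z i j k : (i < 4)%N && (j < 4)%N && (i != j) ->
    [|| q i j, q j i | q i k == q k j].
  case/andP=> /andP[? ?] ij; case: (boolP (q i j)) => //= pij.
  by case: (boolP (q j i)) => //= pji; rewrite /q (anti (o i) (o j)) ?oD.
have O i := ex4 _ (out (o i)); have N i := ex4 _ (inn (o i)).
(* What remains is a tautology in the twelve booleans q i j, i != j. *)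
apply: (implyP _ (O 0%N)); apply: (implyP _ (O 1%N)).
apply: (implyP _ (O 2%N)); apply: (implyP _ (O 3%N)).
apply: (implyP _ (N 0%N)); apply: (implyP _ (N 1%N)).
apply: (implyP _ (N 2%N)); apply: (implyP _ (N 3%N)).
apply: (implyP _ (A 1%N 0%N)); apply: (implyP _ (A 2%N 0%N)).
apply: (implyP _ (A 2%N 1%N)); apply: (implyP _ (A 3%N 0%N)).
apply: (implyP _ (A 3%N 1%N)); apply: (implyP _ (A 3%N 2%N)).
apply: (implyP _ (Z 0%N 1%N 2%N isT)); apply: (implyP _ (Z 0%N 1%N 3%N isT)).
apply: (implyP _ (Z 0%N 2%N 1%N isT)); apply: (implyP _ (Z 0%N 2%N 3%N isT)).
apply: (implyP _ (Z 0%N 3%N 1%N isT)); apply: (implyP _ (Z 0%N 3%N 2%N isT)).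
apply: (implyP _ (Z 1%N 0%N 2%N isT)); apply: (implyP _ (Z 1%N 0%N 3%N isT)).
apply: (implyP _ (Z 1%N 2%N 0%N isT)); apply: (implyP _ (Z 1%N 2%N 3%N isT)).
apply: (implyP _ (Z 1%N 3%N 0%N isT)); apply: (implyP _ (Z 1%N 3%N 2%N isT)).
apply: (implyP _ (Z 2%N 0%N 1%N isT)); apply: (implyP _ (Z 2%N 0%N 3%N isT)).
apply: (implyP _ (Z 2%N 1%N 0%N isT)); apply: (implyP _ (Z 2%N 1%N 3%N isT)).
apply: (implyP _ (Z 2%N 3%N 0%N isT)); apply: (implyP _ (Z 2%N 3%N 1%N isT)).
apply: (implyP _ (Z 3%N 0%N 1%N isT)); apply: (implyP _ (Z 3%N 0%N 2%N isT)).
apply: (implyP _ (Z 3%N 1%N 0%N isT)); apply: (implyP _ (Z 3%N 1%N 2%N isT)).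
apply: (implyP _ (Z 3%N 2%N 0%N isT)); apply: (implyP _ (Z 3%N 2%N 1%N isT)).
rewrite !pF -!/(q _ _) /cycle4.
move: (q 0 1)%N; apply: bothP; move: (q 0 2)%N; apply: bothP.
move: (q 0 3)%N; apply: bothP; move: (q 1 0)%N; apply: bothP.
move: (q 1 2)%N; apply: bothP; move: (q 1 3)%N; apply: bothP.
move: (q 2 0)%N; apply: bothP; move: (q 2 1)%N; apply: bothP.
move: (q 2 3)%N; apply: bothP; move: (q 3 0)%N; apply: bothP.
move: (q 3 1)%N; apply: bothP; move: (q 3 2)%N; apply: bothP.
by vm_compute.
Qed.

(** Both points have polar angles in [0, pi]; the last hypothesis says that the second angle is
    larger, and cosine decreases there. *)
Lemma cos_lt (R : realDomainType) (c1 s1 c2 s2 : R) :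
  c1 ^+ 2 + s1 ^+ 2 = c2 ^+ 2 + s2 ^+ 2 -> 0 < s1 -> 0 <= s2 ->
  c2 * s1 < c1 * s2 -> c2 < c1.
Proof.
move=> e s1_gt0 s2_ge0 lt12; rewrite ltNge; apply/negP => le12.
have {}e : (c2 - c1) * (c2 + c1) = (s1 - s2) * (s1 + s2) by nra.
have [c1_ge0|c1_lt0] := lerP 0 c1; first by have [|] := lerP s2 s1; nra.
have [|] := lerP 0 c2; first by nra.
by have [|] := lerP s1 s2; nra.
Qed.

(** * Chords and angles on a circle about the origin *)

Section Quadrilateral.
Variables (R : realFieldType) (m X Y : 'I_4 -> R) (t : 'I_4 -> 'I_4 -> R).
Variables (W : R -> R) (rho : R).

(** [D i j] and [C i j] are [rho] times the sine and cosine of the oriented angle from point i to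
    point j. *)
Let D i j := X i * Y j - Y i * X j.
Let C i j := X i * X j + Y i * Y j.

Hypothesis m_gt0 : forall i, 0 < m i.
Hypothesis circleXY : forall i, X i ^+ 2 + Y i ^+ 2 = rho.
Hypothesis t_ge0 : forall i j, 0 <= t i j.
Hypothesis tE : forall i j, t i j ^+ 2 = 2 * (rho - C i j).
Hypothesis W_gt0 : forall u, 0 < u -> 0 < W u.
Hypothesis W_decr : forall u v, 0 < u -> u < v -> v ^+ 2 * W v < u ^+ 2 * W u.

Lemma t_sym i j : t i j = t j i.
Proof.
apply/eqP; rewrite -(eqrXn2 (n := 2)) // !tE.
by apply/eqP; rewrite /C; ring.
Qed.

Lemma CDE i j : C i j ^+ 2 + D i j ^+ 2 = rho ^+ 2.
Proof.
have -> : rho ^+ 2 = (X i ^+ 2 + Y i ^+ 2) * (X j ^+ 2 + Y j ^+ 2).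
  by rewrite !circleXY.
by rewrite /C /D; ring.
Qed.

Lemma t_gt0 i j : 0 < D i j -> 0 < t i j.
Proof.
move=> D_gt0; rewrite lt0r t_ge0 andbT -sqrf_eq0 tE; apply/eqP => t0.
have := CDE i j; have -> : C i j = rho by lra.
by apply/eqP; rewrite -subr_eq0 addrAC subrr add0r sqrf_eq0 gt_eqF.
Qed.

Lemma rho_gt0 i j : 0 < D i j -> 0 < rho.
Proof.
move=> D_gt0; rewrite lt0r -{2}(circleXY i) addr_ge0 ?sqr_ge0 // andbT -sqrf_eq0.
by rewrite -(CDE i j) paddr_eq0 ?sqr_ge0 // !sqrf_eq0 (gt_eqF D_gt0) andbF.
Qed.

Lemma t_lt i j k l : (t i j < t k l) = (C k l < C i j).
Proof. by rewrite -ltr_sqr ?nnegrE // !tE ltr_pM2l // ltrD2l ltrN2. Qed.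

Lemma W_lt u v : 0 < u -> u < v -> W v < W u.
Proof.
move=> u_gt0 ltuv; have := W_decr u_gt0 ltuv; have := W_gt0 u_gt0.
have : u ^+ 2 < v ^+ 2 by nra.
move=> *; nra.
Qed.

Lemma W_lt_inv u v : 0 < v -> W v < W u -> u < v.
Proof.
move=> v_gt0; apply: contraTT; rewrite -!leNgt le_eqVlt => /predU1P[->//|].
by move=> /(W_lt v_gt0)/ltW.
Qed.

(** The signs say that going from i through j to k covers at most half a turn, where longer arcs
    have longer chords. The identities fed to [cos_lt] are the formula for the sine of a
    difference. *)
Lemma chord_lt i j k : 0 < D i j -> 0 < D j k -> 0 <= D i k ->
  t i j < t i k /\ t j k < t i k.
Proof.
move=> Dij Djk Dik; rewrite !t_lt; split.
  apply: (@cos_lt _ _ (D i j) _ (D i k)) => //; first by rewrite !CDE.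
  suff -> : C i j * D i k = C i k * D i j + (X i ^+ 2 + Y i ^+ 2) * D j k.
    by rewrite ltrDl mulr_gt0 // circleXY (rho_gt0 Dij).
  by rewrite /C /D; ring.
apply: (@cos_lt _ _ (D j k) _ (D i k)) => //; first by rewrite !CDE.
suff -> : C j k * D i k = C i k * D j k + (X k ^+ 2 + Y k ^+ 2) * D i j.
  by rewrite ltrDl mulr_gt0 // circleXY (rho_gt0 Dij).
by rewrite /C /D; ring.
Qed.

(* D / t = sqrt (rho - t^2 / 4) and t * W t both decrease with t. *)
Lemma weighted_D_lt i j k l s : 0 < D i j -> 0 < D k l ->
  t i j < t k l -> t k l < s ->
  D k l * (W (t k l) - W s) < D i j * (W (t i j) - W s).
Proof.
move=> Dij Dkl lt_t lt_s.
have tij := t_gt0 Dij; have tkl := t_gt0 Dkl.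
have ltD : D k l * t i j < D i j * t k l.
  rewrite -ltr_sqr ?nnegrE ?mulr_ge0 ?ltW // !exprMn !tE.
  have := CDE i j; have := CDE k l; move: lt_t; rewrite t_lt.
  have := @exprn_gt0 _ 2 _ tij; have := @exprn_gt0 _ 2 _ tkl; rewrite !tE.
  move: (C i j) (C k l) => u v Pv Pu ltvu Dv Du.
  have -> : D i j ^+ 2 = (rho - u) * (rho + u) by lra.
  have -> : D k l ^+ 2 = (rho - v) * (rho + v) by lra.
  have P : 0 < (rho - u) * (rho - v) by rewrite mulr_gt0 //; lra.
  have : (rho - u) * (rho - v) * v < (rho - u) * (rho - v) * u by rewrite ltr_pM2l.
  lra.
have Ws : 0 < W s by rewrite W_gt0 // (lt_trans tkl).
have ltW1 := W_lt tkl lt_s; have ltW2 := W_decr tij lt_t.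
have ltWW : t k l * (W (t k l) - W s) < t i j * (W (t i j) - W s).
  rewrite !mulrBr ltrB //; last by rewrite ltr_pM2r.
  rewrite -(ltr_pM2l tij); apply: le_lt_trans (_ : t k l ^+ 2 * W (t k l) < _).
    by rewrite expr2 -mulrA ler_pM2r ?ltW // mulr_gt0 // W_gt0.
  by rewrite mulrA -expr2.
rewrite -(ltr_pM2l tij) -(ltr_pM2l tkl).
have a1 : 0 < t k l * (W (t k l) - W s) by rewrite mulr_gt0 // subr_gt0.
have := ltr_pM (mulr_ge0 (ltW Dkl) (ltW tij)) (ltW a1) ltD ltWW.
by congr (_ < _); ring.
Qed.

Lemma weighted_D_le i j k l s : 0 < D i j -> 0 < D k l ->
  t i j <= t k l -> t k l < s ->
  D k l * (W (t k l) - W s) <= D i j * (W (t i j) - W s).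
Proof.
move=> Dij Dkl; rewrite le_eqVlt => /predU1P[tt|lt_t] lt_s; last first.
  exact/ltW/weighted_D_lt.
suff -> : D i j = D k l by rewrite tt.
apply/eqP; rewrite -(eqrXn2 (n := 2)) ?ltW //; apply/eqP.
have := CDE i j; have := CDE k l; have := tE i j; have := tE k l; rewrite tt => -> ?.
have -> : C i j = C k l by lra.
lra.
Qed.

(** * Center of mass at the origin, and the cyclic order of the points *)

Hypothesis centerX : \sum_j m j * X j = 0.
Hypothesis centerY : \sum_j m j * Y j = 0.

Lemma balance k : \sum_j m j * D j k = 0.
Proof.
transitivity ((\sum_j m j * X j) * Y k - (\sum_j m j * Y j) * X k).
  by rewrite !mulr_suml -sumrB; apply: eq_bigr => j _; rewrite /D; ring.
by rewrite centerX centerY !mul0r subrr.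
Qed.

(** Parallel axis theorem: all points lie at squared distance [rho] from the center of mass, so the
    moment of inertia about each of them is the same. *)
Lemma inertiaE k : \sum_j m j * t j k ^+ 2 = 2 * rho * \sum_j m j.
Proof.
transitivity (2 * rho * (\sum_j m j) -
    2 * ((\sum_j m j * X j) * X k + (\sum_j m j * Y j) * Y k)).
  rewrite !mulr_suml -big_split !mulr_sumr -sumrB.
  by apply: eq_bigr => j _; rewrite tE /C /=; ring.
by rewrite centerX centerY !mul0r addr0 mulr0 subr0.
Qed.

Hypothesis t_neq0 : forall i j, i != j -> t i j != 0.

(** A zero sine leaves [C i j] equal to [rho] or [- rho], and the first would make the two points
    coincide. *)
Lemma antipodal i j : i != j -> D i j = 0 -> X j = - X i /\ Y j = - Y i.
Proof.
move=> ij D0; have := CDE i j; rewrite D0 expr0n addr0 => /eqP.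
rewrite eqf_sqr => /orP[|] /eqP eC.
  by have := t_neq0 ij; rewrite -sqrf_eq0 tE eC subrr mulr0 eqxx.
have : (X i + X j) ^+ 2 + (Y i + Y j) ^+ 2 = 0.
  have := circleXY i; have := circleXY j; rewrite /C in eC; lra.
move/eqP; rewrite paddr_eq0 ?sqr_ge0 // !sqrf_eq0 => /andP[/eqP ? /eqP ?].
by split; lra.
Qed.

(** Addition is modulo 4, so [i + 1] and [i + 1 + 1] are two labels other than i; both points would
    be antipodal to i, hence equal. *)
Lemma D_not_all0 i : ~ (forall j, D i j = 0).
Proof.
move=> D0.
have i1 : i != i + 1 by rewrite -subr_eq0 opprD addrA subrr.
have i2 : i != i + 1 + 1 by rewrite -addrA -subr_eq0 opprD addrA subrr.
have [X1 Y1] := antipodal i1 (D0 _); have [X2 Y2] := antipodal i2 (D0 _).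
have : t (i + 1) (i + 1 + 1) ^+ 2 = 0.
  by rewrite tE -(circleXY (i + 1)) /C X1 Y1 X2 Y2; ring.
move/eqP; rewrite sqrf_eq0; apply/negP/t_neq0.
by rewrite -subr_eq0 opprD addrA subrr.
Qed.

(** Each of the four turns is strictly between 0 and half a turn, and their sum is a multiple of a
    full turn, so the cycle goes around exactly once. *)
Definition counterclockwise a b c d :=
  [&& uniq [:: a; b; c; d], 0 < D a b, 0 < D b c, 0 < D c d & 0 < D d a].

Lemma counterclockwise_rot a b c d :
  counterclockwise a b c d -> counterclockwise b c d a.
Proof.
case/and5P=> u ? ? ? ?; apply/and5P; split=> //.
by rewrite -(rot_uniq 3).
Qed.

(** If one side of the line through the center and point i were empty, [balance] would be a
    vanishing sum of terms of one sign, so every [D i j] would be 0. *)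
Lemma exists_counterclockwise : exists a b c d, counterclockwise a b c d.
Proof.
have Dnn i j : D j i = - D i j by rewrite /D; ring.
have [||||a [b [c [d [u /and4P[? ? ? ?]]]]]] :=
    @exists_directed_4cycle (fun i j => 0 < D i j); last 1 first.
- by exists a, b, c, d; apply/and5P.
- move=> i; apply/existsP; apply: contraT; rewrite negb_exists => /forallP D_le0.
  have mD_ge0 j : 0 <= m j * D j i.
    by apply: mulr_ge0; [exact: ltW | rewrite Dnn oppr_ge0 leNgt D_le0].
  case: (@D_not_all0 i) => j; apply/eqP; rewrite Dnn oppr_eq0.
  have /eqP := balance i; rewrite psumr_eq0 // => /allP/(_ j (mem_index_enum _)).
  by rewrite mulf_eq0 gt_eqF.
- move=> i; apply/existsP; apply: contraT; rewrite negb_exists => /forallP D_le0.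
  have mD_ge0 j : 0 <= - (m j * D j i).
    by rewrite oppr_ge0 pmulr_rle0 // leNgt D_le0.
  case: (@D_not_all0 i) => j; apply/eqP; rewrite Dnn oppr_eq0.
  have : \sum_j - (m j * D j i) == 0 by rewrite sumrN balance oppr0.
  rewrite psumr_eq0 // => /allP/(_ j (mem_index_enum _)).
  by rewrite oppr_eq0 mulf_eq0 gt_eqF.
- by move=> i j; rewrite (Dnn i j) oppr_gt0 -leNgt => /ltW.
move=> i j k ij; rewrite (Dnn i j) oppr_gt0 -!leNgt => le ge.
have [|Xj Yj] := antipodal ij; first by apply/eqP; rewrite eq_le le.
by congr (0 < _); rewrite /D Xj Yj; ring.
Qed.

(** * Consequences of the force equations: equal masses and a square *)

Variable kappa : R.
Hypothesis forceX : forall k, \sum_j m j * W (t j k) * (X j - X k) = - kappa * X k.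
Hypothesis forceY : forall k, \sum_j m j * W (t j k) * (Y j - Y k) = - kappa * Y k.

Lemma tangential k : \sum_j m j * W (t j k) * D j k = 0.
Proof.
transitivity (- kappa * X k * Y k - - kappa * Y k * X k); last by ring.
rewrite -forceX -forceY !mulr_suml -sumrB; apply: eq_bigr => j _.
by rewrite /D; ring.
Qed.

(** As all radii are equal, the squared distance from j to k is -2 times the inner product of (j -
    k) with k; the force equation is paired with k. *)
Lemma potentialE k : \sum_j m j * (t j k ^+ 2 * W (t j k)) = 2 * kappa * rho.
Proof.
transitivity (- 2 * (- kappa * X k * X k + - kappa * Y k * Y k)); last first.
  by rewrite -(circleXY k); ring.
rewrite -forceX -forceY !mulr_suml -big_split mulr_sumr; apply: eq_bigr => j _.
by rewrite tE -(circleXY k) /C /=; ring.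
Qed.

(** Subtracting [W (t a c)] times [balance a] from [tangential a] removes the term of c, and the
    term of a is zero because [D a a = 0]. *)
Lemma tangential_pair a b c d : counterclockwise a b c d ->
  m b * (D a b * (W (t a b) - W (t a c))) = m d * (D d a * (W (t d a) - W (t a c))).
Proof.
case/andP=> u _; have := balance a; have := tangential a.
rewrite !(sum_ord4 _ u) (t_sym c a) (t_sym b a) => T B.
suff : m b * (W (t a b) - W (t a c)) * D b a + m d * (W (t d a) - W (t a c)) * D d a = 0.
  rewrite (_ : D b a = - D a b); [lra | by rewrite /D; ring].
have Daa : D a a = 0 by rewrite /D; ring.
by move: T (congr1 ( *%R (W (t a c))) B); rewrite Daa; lra.
Qed.

(** One of the two arcs from a to c is at most half a turn, and [chord_lt] treats its two sides.
    [tangential_pair] at a and at c carries the sign of [W t - W (t a c)] over to the sides of the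
    other arc. *)
Lemma sides_lt_diagonal a b c d : counterclockwise a b c d ->
  [/\ t a b < t a c, t b c < t a c, t c d < t a c & t d a < t a c].
Proof.
have wlogD a' b' c' d' : counterclockwise a' b' c' d' -> 0 <= D a' c' ->
    [/\ t a' b' < t a' c', t b' c' < t a' c', t c' d' < t a' c' & t d' a' < t a' c'].
  move=> ccw Dac.
  have := tangential_pair ccw.
  have := tangential_pair (counterclockwise_rot (counterclockwise_rot ccw)).
  case/and5P: ccw => _ Dab Dbc Dcd Dda; rewrite (t_sym c' a').
  have [ltab ltbc] := chord_lt Dab Dbc Dac => e2 e1.
  have tac : 0 < t a' c' := lt_trans (t_gt0 Dab) ltab.
  split=> //; apply: W_lt_inv => //; rewrite -subr_gt0.
    rewrite -(pmulr_rgt0 _ Dcd) -(pmulr_rgt0 _ (m_gt0 d')) e2.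
    by rewrite !mulr_gt0 // subr_gt0 W_lt // t_gt0.
  rewrite -(pmulr_rgt0 _ Dda) -(pmulr_rgt0 _ (m_gt0 d')) -e1.
  by rewrite !mulr_gt0 // subr_gt0 W_lt // t_gt0.
move=> ccw; have [/wlogD|Dac] := lerP 0 (D a c); first exact.
have [||] := wlogD c d a b; first by do 2!apply: counterclockwise_rot.
  by rewrite (_ : D c a = - D a c) ?oppr_ge0 ?ltW // /D; ring.
by rewrite (t_sym c a); split.
Qed.

Lemma opposite_mass_eq a b c d : counterclockwise a b c d -> m a = m c.
Proof.
move=> ccw; have ccw2 := counterclockwise_rot (counterclockwise_rot ccw).
have [ltab ltbc ltcd ltda] := sides_lt_diagonal ccw.
have ea := tangential_pair ccw; have ec := tangential_pair ccw2.
rewrite (t_sym c a) in ec.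
case/and5P: ccw => u Dab Dbc Dcd Dda {ccw2}.
(* With f the decreasing function of [weighted_D_lt], [ea] and [ec] read m b * f(ab) = m d * f(da)
   and m b * f(bc) = m d * f(cd), so either comparison of sides carries over to the other. *)
have lt1 : t a b < t b c -> t d a < t c d.
  move=> ltt; have := weighted_D_lt Dab Dbc ltt ltbc.
  rewrite -(ltr_pM2l (m_gt0 b)) ea -ec ltr_pM2l //.
  by apply: contraLR; rewrite -!leNgt => le; apply: weighted_D_le.
have lt2 : t b c < t a b -> t c d < t d a.
  move=> ltt; have := weighted_D_lt Dbc Dab ltt ltab.
  rewrite -(ltr_pM2l (m_gt0 b)) ea -ec ltr_pM2l //.
  by apply: contraLR; rewrite -!leNgt => le; apply: weighted_D_le.
have lt3 : t d a < t c d -> t a b < t b c.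
  move=> ltt; have := weighted_D_lt Dda Dcd ltt ltcd.
  rewrite -(ltr_pM2l (m_gt0 d)) -ea ec ltr_pM2l //.
  by apply: contraLR; rewrite -!leNgt => le; apply: weighted_D_le.
have lt4 : t c d < t d a -> t b c < t a b.
  move=> ltt; have := weighted_D_lt Dcd Dda ltt ltda.
  rewrite -(ltr_pM2l (m_gt0 d)) -ea ec ltr_pM2l //.
  by apply: contraLR; rewrite -!leNgt => le; apply: weighted_D_le.
have t0 i : t i i ^+ 2 = 0 by rewrite tE -(circleXY i) /C; ring.
pose h i j := t i j ^+ 2 * W (t i j).
have eI : (m c - m a) * t a c ^+ 2 =
    m b * (t b c ^+ 2 - t a b ^+ 2) + m d * (t c d ^+ 2 - t d a ^+ 2).
  have := etrans (inertiaE a) (esym (inertiaE c)).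
  rewrite !(sum_ord4 _ u) !t0 (t_sym c a) (t_sym b a) (t_sym d c); lra.
have eP : (m c - m a) * h a c = m b * (h b c - h a b) + m d * (h c d - h d a).
  have := etrans (potentialE a) (esym (potentialE c)).
  rewrite !(sum_ord4 _ u) !t0 (t_sym c a) (t_sym b a) (t_sym d c) /h; lra.
have I_gt0 : 0 < t a c ^+ 2 by rewrite exprn_gt0 // (lt_trans _ ltab) ?t_gt0.
have P_gt0 : 0 < h a c by rewrite mulr_gt0 ?W_gt0 // (lt_trans _ ltab) ?t_gt0.
have lt_h i j k l : 0 < D i j -> t i j < t k l -> (h k l < h i j) * (t i j ^+ 2 < t k l ^+ 2).
  by move=> Dij lt_t; split; rewrite ?W_decr ?t_gt0 // ltr_sqr ?nnegrE.
(* Unequal sides would give the right-hand sides of [eI] and [eP] opposite signs, while both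
   left-hand sides are [m c - m a] times a positive factor. *)
have [lt|gt|eq1] := ltgtP (t a b) (t b c).
- have [h1 s1] := lt_h _ _ _ _ Dab lt; have [h2 s2] := lt_h _ _ _ _ Dda (lt1 lt).
  have : 0 < (m c - m a) * t a c ^+ 2 by rewrite eI addr_gt0 // mulr_gt0 // subr_gt0.
  have : (m c - m a) * h a c < 0.
    have : m b * (h b c - h a b) < 0 by rewrite pmulr_rlt0 // subr_lt0.
    have : m d * (h c d - h d a) < 0 by rewrite pmulr_rlt0 // subr_lt0.
    by rewrite eP; lra.
  by rewrite pmulr_llt0 // pmulr_lgt0 //; lra.
- have [h1 s1] := lt_h _ _ _ _ Dbc gt; have [h2 s2] := lt_h _ _ _ _ Dcd (lt2 gt).
  have : (m c - m a) * t a c ^+ 2 < 0.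
    have : m b * (t b c ^+ 2 - t a b ^+ 2) < 0 by rewrite pmulr_rlt0 // subr_lt0.
    have : m d * (t c d ^+ 2 - t d a ^+ 2) < 0 by rewrite pmulr_rlt0 // subr_lt0.
    by rewrite eI; lra.
  have : 0 < (m c - m a) * h a c by rewrite eP addr_gt0 // mulr_gt0 // subr_gt0.
  by rewrite pmulr_llt0 // pmulr_lgt0 //; lra.
have eq2 : t c d = t d a.
  case: (ltgtP (t c d) (t d a)) => // [/lt4|/lt3]; rewrite eq1 ltxx //.
move: eI; rewrite eq1 eq2 !subrr !mulr0 addr0 => /eqP.
by rewrite mulf_eq0 (gt_eqF I_gt0) orbF subr_eq0 => /eqP.
Qed.

(* The vector (px, py) = a + c is parallel to b + d, hence orthogonal to both
   diagonals, whose determinant delta is a sum of four positive D's. *)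
Lemma opposite_points a b c d : counterclockwise a b c d ->
  [/\ X c = - X a, Y c = - Y a, X d = - X b & Y d = - Y b].
Proof.
move=> ccw; have mac := opposite_mass_eq ccw.
have mbd := opposite_mass_eq (counterclockwise_rot ccw).
case/and5P: ccw => u Dab Dbc Dcd Dda.
move: centerX centerY; rewrite !(sum_ord4 _ u) -mac -mbd => cX cY.
have ma := m_gt0 a; have mb := m_gt0 b.
pose px := X a + X c; pose py := Y a + Y c.
have [p1 p2] : (X a - X c) * px + (Y a - Y c) * py = 0 /\
    (X b - X d) * px + (Y b - Y d) * py = 0.
  split; first by have := circleXY a; have := circleXY c; rewrite /px /py; nra.
  apply: (mulfI (lt0r_neq0 ma)); rewrite mulr0.
  have -> : m a * ((X b - X d) * px + (Y b - Y d) * py) =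
     (X b - X d) * (m a * px) + (Y b - Y d) * (m a * py) by ring.
  have -> : m a * px = - (m b * (X b + X d)) by rewrite /px; lra.
  have -> : m a * py = - (m b * (Y b + Y d)) by rewrite /py; lra.
  transitivity (- m b * ((X b ^+ 2 + Y b ^+ 2) - (X d ^+ 2 + Y d ^+ 2))); first ring.
  by rewrite !circleXY subrr mulr0.
pose delta := D a b + D b c + D c d + D d a.
have delta_neq0 : delta != 0 by rewrite gt_eqF // /delta; do ?apply: addr_gt0 => //.
(* Cramer's rule for the linear system [p1], [p2], whose determinant is [delta]. *)
have px0 : px = 0.
  apply: (mulfI delta_neq0); rewrite mulr0.
  transitivity (((X a - X c) * px + (Y a - Y c) * py) * (Y b - Y d) -
    ((X b - X d) * px + (Y b - Y d) * py) * (Y a - Y c)); first by rewrite /delta /D; ring.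
  by rewrite p1 p2 !mul0r subrr.
have py0 : py = 0.
  apply: (mulfI delta_neq0); rewrite mulr0.
  transitivity (((X b - X d) * px + (Y b - Y d) * py) * (X a - X c) -
    ((X a - X c) * px + (Y a - Y c) * py) * (X b - X d)); first by rewrite /delta /D; ring.
  by rewrite p1 p2 !mul0r subrr.
have Xbd : m b * (X b + X d) = 0.
  by transitivity (- (m a * px)); [rewrite /px; lra | rewrite px0; ring].
have Ybd : m b * (Y b + Y d) = 0.
  by transitivity (- (m a * py)); [rewrite /py; lra | rewrite py0; ring].
move/eqP: Xbd; rewrite mulf_eq0 (gt_eqF mb) /= => /eqP Xbd.
move/eqP: Ybd; rewrite mulf_eq0 (gt_eqF mb) /= => /eqP Ybd.
by rewrite /px in px0; rewrite /py in py0; split; lra.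
Qed.

(** With opposite points antipodal, [D d a = D a b], so [tangential_pair] and the monotonicity of
    [W] give equal sides ab and da. Their cosines are opposite, hence both zero. *)
Lemma orthogonal_equal_masses a b c d : counterclockwise a b c d ->
  C a b = 0 /\ m a = m b.
Proof.
move=> ccw; have [Xc Yc Xd Yd] := opposite_points ccw.
have mac := opposite_mass_eq ccw.
have mbd := opposite_mass_eq (counterclockwise_rot ccw).
have [ltab _ _ _] := sides_lt_diagonal ccw.
have := tangential_pair ccw.
case/and5P: ccw => u Dab Dbc Dcd Dda; have tab := t_gt0 Dab.
have -> : D d a = D a b by rewrite /D Xd Yd; ring.
rewrite -mbd => /(mulfI (lt0r_neq0 (m_gt0 b)))/(mulfI (lt0r_neq0 Dab))/addIr eW.
have tab_da : t a b = t d a.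
  case: (ltgtP (t a b) (t d a)) => //.
    by move/(W_lt tab); rewrite eW ltxx.
  by move/(W_lt (t_gt0 Dda)); rewrite eW ltxx.
have t_eq i j k l : C i j = C k l -> t i j = t k l.
  by move=> e; apply/eqP; rewrite -(eqrXn2 (n := 2)) // !tE e.
have Cab : C a b = 0.
  have := tE a b; have := tE d a; rewrite tab_da => ->.
  have -> : C d a = - C a b by rewrite /C Xd Yd; ring.
  lra.
split=> //; have t0 i : t i i ^+ 2 = 0 by rewrite tE -(circleXY i) /C; ring.
have := etrans (potentialE a) (esym (potentialE b)).
rewrite !(sum_ord4 _ u) !t0 -mac -mbd (t_sym b a) -tab_da.
have -> : t c b = t a b by apply: t_eq; rewrite Cab -[RHS]oppr0 -Cab /C Xc Yc; ring.
have -> : t d b = t a c.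
  transitivity (t b d); first exact: t_sym.
  apply: t_eq; transitivity (- (X b ^+ 2 + Y b ^+ 2)); first by rewrite /C Xd Yd; ring.
  by rewrite circleXY -(circleXY a) /C Xc Yc; ring.
rewrite (t_sym c a); have h1 := W_decr tab ltab.
have h2 : 0 < t a b ^+ 2 * W (t a b) by rewrite mulr_gt0 ?exprn_gt0 ?W_gt0.
move: h1 h2; move: (_ * W (t a b)) (_ * W (t a c)) => h1 h2 lt21 h1_gt0 e.
(* [e] amounts to (m a - m b) * (2 * h1 - h2) = 0, where the diagonal term [h2] is smaller than the
   side term [h1]. *)
apply: (mulIf (_ : 2 * h1 - h2 != 0)); first by rewrite gt_eqF //; lra.
lra.
Qed.

End Quadrilateral.

(** * Dot products, cross products and plane coordinates in space *)

Section DotProduct.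
Variables (R : realType) (n : nat).
Implicit Types (u v w : 'rV[R]_n).

Lemma dotpC u v : dotp u v = dotp v u.
Proof. by apply: eq_bigr => i _; rewrite mulrC. Qed.

Lemma dotpDr u v w : dotp u (v + w) = dotp u v + dotp u w.
Proof. by rewrite -big_split; apply: eq_bigr => i _; rewrite mxE mulrDr. Qed.

Lemma dotpZr a u v : dotp u (a *: v) = a * dotp u v.
Proof. by rewrite [RHS]mulr_sumr; apply: eq_bigr => i _; rewrite mxE mulrCA. Qed.

Lemma dotpNr u v : dotp u (- v) = - dotp u v.
Proof. by rewrite -scaleN1r dotpZr mulN1r. Qed.

Lemma dotpDl u v w : dotp (v + w) u = dotp v u + dotp w u.
Proof. by rewrite dotpC dotpDr !(dotpC u). Qed.

Lemma dotpNl u v : dotp (- v) u = - dotp v u.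
Proof. by rewrite dotpC dotpNr dotpC. Qed.

Lemma dotpZl a u v : dotp (a *: v) u = a * dotp v u.
Proof. by rewrite dotpC dotpZr dotpC. Qed.

Lemma dotp0r u : dotp u 0 = 0.
Proof. by rewrite -(scale0r 0) dotpZr mul0r. Qed.

Lemma dotp_sumr (I : Type) (s : seq I) (P : pred I) u (F : I -> 'rV[R]_n) :
  dotp u (\sum_(i <- s | P i) F i) = \sum_(i <- s | P i) dotp u (F i).
Proof. exact: (big_morph _ (dotpDr u) (dotp0r u)). Qed.

Lemma dotp_ge0 u : 0 <= dotp u u.
Proof. by rewrite sumr_ge0 // => i _; rewrite -expr2 sqr_ge0. Qed.

Lemma dotp_eq0 u : (dotp u u == 0) = (u == 0).
Proof.
apply/eqP/eqP => [/eqP|->]; last exact: dotp0r.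
rewrite psumr_eq0 => [/allP u0|i _]; last by rewrite -expr2 sqr_ge0.
apply/rowP => i; have := u0 i (mem_index_enum _).
by rewrite mulf_eq0 orbb mxE => /eqP.
Qed.

Lemma enorm_sqr u : enorm u ^+ 2 = dotp u u.
Proof. by rewrite sqr_sqrtr ?dotp_ge0. Qed.

End DotProduct.

(** Indices are added modulo 3, so [i + 1] and [i + 1 + 1] are the cyclic successors of i. *)
Definition crossp (R : realType) (u v : 'rV[R]_3) : 'rV[R]_3 :=
  \row_i (u 0 (i + 1) * v 0 (i + 1 + 1) - u 0 (i + 1 + 1) * v 0 (i + 1)).

(* det(u, v, p) * det(u, v, q) is the Gram determinant of (u, v, p), (u, v, q). *)
Lemma dotp_crossp (R : realType) (u v p q : 'rV[R]_3) :
  dotp u v = 0 -> dotp u p = 0 -> dotp u q = 0 ->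
  dotp (crossp u v) p * dotp (crossp u v) q =
  dotp u u * (dotp v v * dotp p q - dotp v p * dotp v q).
Proof.
move=> uv up uq.
transitivity (dotp u u * (dotp v v * dotp p q - dotp v p * dotp v q)
  - dotp u v * (dotp u v * dotp p q - dotp v p * dotp u q)
  + dotp u p * (dotp u v * dotp v q - dotp v v * dotp u q)); last first.
  by rewrite uv up uq; ring.
have sum3 (F : 'I_3 -> R) : \sum_i F i = F 0 + F 1 + F (1 + 1).
  rewrite !big_ord_recl big_ord0 /= addr0 addrA.
  by congr (_ + _ + _); congr F; apply/val_inj.
rewrite /dotp !sum3 !mxE.
have -> : 0 + 1 = 1 :> 'I_3 by apply/val_inj.
have -> : 1 + 1 + 1 = 0 :> 'I_3 by apply/val_inj.
have -> : 0 + 1 = 1 :> 'I_3 by apply/val_inj.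
move: (u 0 0) (u 0 1) (u 0 (1 + 1)) (v 0 0) (v 0 1) (v 0 (1 + 1)).
move: (p 0 0) (p 0 1) (p 0 (1 + 1)) (q 0 0) (q 0 1) (q 0 (1 + 1)).
clear; move=> q2 q1 q0 p2 p1 p0 v2 v1 v0 u2 u1 u0.
by ring.
Qed.

Lemma plane_frame (R : realType) (nu w : 'rV[R]_3) :
  nu != 0 -> w != 0 -> dotp nu w = 0 ->
  exists u v : 'rV[R]_3, forall p q, dotp nu p = 0 -> dotp nu q = 0 ->
    dotp p q = dotp u p * dotp u q + dotp v p * dotp v q.
Proof.
rewrite -(dotp_eq0 nu) -(dotp_eq0 w) => nu0 w0 nuw.
(* An orthonormal basis of the plane orthogonal to [nu]; the cross product has norm
   [enorm nu * enorm w] because [nu] and [w] are orthogonal. *)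
exists ((enorm w)^-1 *: w), ((enorm nu * enorm w)^-1 *: crossp nu w) => p q nup nuq.
rewrite !dotpZl (mulrACA _ (dotp w p)) (mulrACA _ (dotp _ p)) dotp_crossp //.
rewrite -!expr2 !exprVn !exprMn !enorm_sqr.
by field; rewrite nu0 w0.
Qed.

Lemma square_in_some_orderP (R : realType) (x : 'I_4 -> 'rV[R]_3) :
  square_in_some_order x <->
  exists a b c d, uniq [:: a; b; c; d] /\ square (x a) (x b) (x c) (x d).
Proof.
split=> [[s sq]|[a [b [c [d [u sq]]]]]].
  do 4!eexists; split; last exact: sq.
  rewrite -[X in uniq X]/(map (fun i => s (inord i)) (iota 0 4)) map_inj_in_uniq
    ?iota_uniq // => i j; rewrite !mem_iota => /= ? ? /perm_inj/(congr1 val).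
  by rewrite /= !inordK.
have inj : injective (fun i : 'I_4 => nth a [:: a; b; c; d] i).
  by move=> i j /eqP; rewrite nth_uniq // => /eqP/val_inj.
by exists (perm inj); rewrite !permE !inordK.
Qed.

Section CenterOfMass.
Variables (R : realType) (m : 'I_4 -> R) (x : 'I_4 -> 'rV[R]_3).
Hypothesis m_gt0 : forall k, 0 < m k.
Let q k := x k - center_of_mass m x.

Lemma sum_mass_centered : \sum_k m k *: q k = 0.
Proof.
have M0 : \sum_k m k != 0.
  rewrite gt_eqF // (bigD1 ord0) //= ltr_pwDl // sumr_ge0 // => k _; exact/ltW.
under eq_bigr => k _ do rewrite scalerBr.
by rewrite sumrB -scaler_suml scalerA divff // scale1r subrr.
Qed.

End CenterOfMass.

(** * The power-law weight and the two implications *)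

Section CentralSquares.
Variables (R : realType) (alpha : R).
Hypothesis alpha_gt0 : 0 < alpha.

Let W (r : R) := (r `^ (alpha + 2))^-1.

Lemma weight_gt0 r : 0 < r -> 0 < W r.
Proof. by move=> r_gt0; rewrite invr_gt0 powR_gt0. Qed.

(** [z ^+ 2 * W z] is z to the power -alpha, which decreases because alpha is positive. *)
Lemma sqr_weight_decr r s : 0 < r -> r < s -> s ^+ 2 * W s < r ^+ 2 * W r.
Proof.
move=> r_gt0 lt_rs; have s_gt0 := lt_trans r_gt0 lt_rs.
have WE z : 0 < z -> z ^+ 2 * W z = (z `^ alpha)^-1.
  move=> z_gt0; rewrite /W powRD; last by rewrite (gt_eqF z_gt0) implybT.
  rewrite (powR_mulrn 2 (ltW z_gt0)) invfM mulrCA divff ?mulr1 //.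
  by rewrite expf_neq0 // gt_eqF.
rewrite !WE // ltf_pV2 ?posrE ?powR_gt0 //.
by apply: gt0_ltr_powR; rewrite // nnegrE ltW.
Qed.

Lemma square_of_central (m : 'I_4 -> R) (x : 'I_4 -> 'rV[R]_3) :
  (forall k, 0 < m k) -> injective x -> centered_cocircular m x ->
  central_configuration alpha m x ->
  (forall i j, m i = m j) /\ square_in_some_order x.
Proof.
move=> m_gt0 x_inj [nu [r [nu0 r_gt0 circ]]] [lambda cc].
(* Obtaining [q] from an existence statement keeps it opaque, so the center of mass never
   unfolds. *)
have [q qdef] : exists q : 'I_4 -> 'rV[R]_3, forall k, x k - center_of_mass m x = q k.
  by eexists.
have nuq k : dotp nu (q k) = 0 by rewrite -qdef; case: (circ k).
have qq k : dotp (q k) (q k) = r ^+ 2.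
  by rewrite -enorm_sqr -qdef; case: (circ k) => _ ->.
have q0 : q ord0 != 0 by rewrite -dotp_eq0 qq expf_neq0 // gt_eqF.
have [u [v frame]] := plane_frame nu0 q0 (nuq _).
pose X k := dotp u (q k); pose Y k := dotp v (q k).
pose t i j := enorm (x i - x j).
have qE i j : dotp (q i) (q j) = X i * X j + Y i * Y j by exact: frame.
have qB i j : x i - x j = q i - q j by rewrite -!qdef opprB addrA subrK.
have circleXY k : X k ^+ 2 + Y k ^+ 2 = r ^+ 2 by rewrite -(qq k) qE.
have t_ge0 i j : 0 <= t i j by exact: sqrtr_ge0.
have tE i j : t i j ^+ 2 = 2 * (r ^+ 2 - (X i * X j + Y i * Y j)).
  rewrite enorm_sqr qB !(dotpDl, dotpDr, dotpNl, dotpNr) !qq (dotpC (q j)) qE; ring.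
have t_neq0 i j : i != j -> t i j != 0.
  move=> ij; rewrite -sqrf_eq0 enorm_sqr dotp_eq0 subr_eq0.
  by apply: contra ij => /eqP/x_inj ->.
have center e : \sum_j m j * dotp e (q j) = 0.
  transitivity (dotp e (\sum_j m j *: q j)).
    by rewrite dotp_sumr; apply: eq_bigr => j _; rewrite dotpZr.
  rewrite (_ : \sum_j _ = 0) ?dotp0r // -[RHS](sum_mass_centered x m_gt0).
  by apply: eq_bigr => j _; rewrite qdef.
have force e k : \sum_j m j * W (t j k) * (dotp e (q j) - dotp e (q k)) =
    - (lambda / alpha) * dotp e (q k).
  have := congr1 (dotp e) (cc k); rewrite dotp_sumr dotpZr qdef => ek.
  apply: (mulfI (lt0r_neq0 (m_gt0 k))).
  transitivity (- (lambda / alpha * m k) * dotp e (q k)); last by ring.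
  (* The planar force sums include j = k; that term vanishes whatever the weight at distance 0
     is. *)
  have force_kk w : m k * (m k * w * (dotp e (q k) - dotp e (q k))) = 0.
    by rewrite subrr !mulr0.
  rewrite -ek mulr_sumr (bigD1 k) // force_kk /= add0r; apply: eq_bigr => j _.
  have reassoc (w z : R) : m k * (m j * w^-1 * z) = m j * m k / w * z.
    by rewrite !mulrA (mulrC (m k)).
  have -> : dotp e (q j) - dotp e (q k) = dotp e (x j - x k).
    by rewrite qB dotpDr dotpNr.
  by rewrite dotpZr -reassoc.
have [a [b [c [d ccw]]]] :=
  exists_counterclockwise m_gt0 circleXY tE (center u) (center v) t_neq0.
have [Xc Yc Xd Yd] := opposite_points m_gt0 circleXY t_ge0 tE weight_gt0 sqr_weight_decr
  (center u) (center v) (force u) (force v) ccw.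
have [Cab mab] := orthogonal_equal_masses m_gt0 circleXY t_ge0 tE weight_gt0 sqr_weight_decr
  (center u) (center v) (force u) (force v) ccw.
have mac := opposite_mass_eq m_gt0 circleXY t_ge0 tE weight_gt0 sqr_weight_decr
  (center u) (center v) (force u) (force v) ccw.
have mbd := opposite_mass_eq m_gt0 circleXY t_ge0 tE weight_gt0 sqr_weight_decr
  (center u) (center v) (force u) (force v) (counterclockwise_rot ccw).
case/and5P: ccw => u4 _ _ _ _.
(* Opposite coordinates give [q i + q j] squared norm 0, which yields the equality of vectors in
   space. *)
have oppq i j : X j = - X i -> Y j = - Y i -> q j = - q i.
  move=> Xj Yj; apply/eqP; rewrite -addr_eq0 -dotp_eq0.
  rewrite dotpDl !dotpDr !qq (dotpC (q j)) qE Xj Yj -(circleXY i).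
  by apply/eqP; ring.
have qc := oppq _ _ Xc Yc; have qd := oppq _ _ Xd Yd.
split.
  have mE i : m i = m a.
    by have := mem_uniq4 i u4; rewrite !inE => /or4P[] /eqP->; rewrite // -?mbd.
  by move=> i j; rewrite !mE.
apply/square_in_some_orderP; exists a, b, c, d; split=> //.
have qab : dotp (q a) (q b) = 0 by rewrite qE.
split.
- by apply/eqP => /x_inj ab; move: u4; rewrite ab /= !inE eqxx.
- by rewrite !qB qc qd opprK addrC.
- rewrite /enorm !qB qd !(dotpDl, dotpDr, dotpNl, dotpNr) (dotpC (q b)) qab.
  by congr Num.sqrt; ring.
rewrite !qB qd !(dotpDl, dotpDr, dotpNl, dotpNr) (dotpC (q b)) qab !qq; ring.
Qed.

(* 2 * rho and 4 * rho are the squared side and diagonal of the square. *)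
Lemma force_at_vertex (m : 'I_4 -> R) (x q : 'I_4 -> 'rV[R]_3) (mu rho : R) a b c d :
  uniq [:: a; b; c; d] -> (forall k, m k = mu) ->
  (forall i j, x i - x j = q i - q j) ->
  dotp (q a) (q a) = rho -> dotp (q b) (q b) = rho -> dotp (q a) (q b) = 0 ->
  q c = - q a -> q d = - q b ->
  \sum_(j < 4 | j != a) (m j * m a / enorm (x j - x a) `^ (alpha + 2)) *: (x j - x a) =
  - (mu * (2 * W (Num.sqrt (2 * rho)) + 2 * W (Num.sqrt (4 * rho))) * m a) *: q a.
Proof.
move=> u mE qB qa qb qab qc qd.
have -> (F : 'I_4 -> 'rV[R]_3) : \sum_(j < 4 | j != a) F j = F b + F c + F d.
  apply: (addrI (F a)); transitivity (\sum_j F j); first by rewrite [RHS](bigD1 a).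
  by rewrite (sum_ord4 _ u) !addrA.
have L : enorm (x b - x a) = Num.sqrt (2 * rho).
  congr Num.sqrt; rewrite qB !(dotpDl, dotpDr, dotpNl, dotpNr) qa qb (dotpC (q b)) qab; ring.
have L' : enorm (x d - x a) = Num.sqrt (2 * rho).
  congr Num.sqrt; rewrite qB qd !(dotpDl, dotpDr, dotpNl, dotpNr) qa qb (dotpC (q b)) qab; ring.
have E : enorm (x c - x a) = Num.sqrt (4 * rho).
  congr Num.sqrt; rewrite qB qc !(dotpDl, dotpDr, dotpNl, dotpNr) qa; ring.
rewrite L L' E !qB qc qd !mE -/(W _) -/(W _).
by apply/rowP => i; rewrite !mxE; ring.
Qed.

Lemma central_of_square (m : 'I_4 -> R) (x : 'I_4 -> 'rV[R]_3) :
  (forall k, 0 < m k) -> (forall i j, m i = m j) -> square_in_some_order x ->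
  central_configuration alpha m x.
Proof.
move=> m_gt0 mE /square_in_some_orderP[a [b [c [d [u [_ para sides ortho]]]]]].
have [q qdef] : exists q : 'I_4 -> 'rV[R]_3, forall k, x k - center_of_mass m x = q k.
  by eexists.
have qB i j : x i - x j = q i - q j by rewrite -!qdef opprB addrA subrK.
have q_sum : q a + q b + q c + q d = 0.
  apply: (scalerI (lt0r_neq0 (m_gt0 a))); rewrite scaler0.
  rewrite -[RHS](sum_mass_centered x m_gt0) -(sum_ord4 _ u) scaler_sumr.
  by apply: eq_bigr => k _; rewrite qdef (mE k a).
move: para sides ortho; rewrite !qB => para sides ortho.
have qac : q a + q c = q b + q d.
  apply: (addIr (- q a - q d)).
  have -> : q a + q c + (- q a - q d) = q c - q d by rewrite addrACA subrr add0r.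
  by rewrite -para addrACA subrr addr0.
have qbd : q b + q d = 0.
  apply: (scalerI (_ : 2 != 0 :> R)); first by rewrite pnatr_eq0.
  rewrite scaler0 -q_sum scaler_nat mulr2n -{1}qac.
  by rewrite -!addrA; congr (_ + _); rewrite addrCA.
have qd : q d = - q b by apply/eqP; rewrite -addr_eq0 addrC qbd.
have qc : q c = - q a by apply/eqP; rewrite -addr_eq0 addrC qac qbd.
have := congr1 (fun z => z ^+ 2) sides; rewrite !enorm_sqr.
move: ortho; rewrite qd !(dotpDl, dotpDr, dotpNl, dotpNr) (dotpC (q b)) => o s.
(* With opposite vertices antipodal, the equal sides in [s] make the diagonals orthogonal, and the
   right angle in [o] makes them equally long. *)
have qab : dotp (q a) (q b) = 0 by lra.
have qb : dotp (q b) (q b) = dotp (q a) (q a) by lra.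
pose rho := dotp (q a) (q a).
(* The two side vectors at a vertex add up to -2 times its position, and so does the diagonal vector
   alone; this explains both factors 2. The factor [alpha] cancels the division in the
   definition. *)
exists (alpha * (m a * (2 * W (Num.sqrt (2 * rho)) + 2 * W (Num.sqrt (4 * rho))))) => k.
rewrite qdef [alpha * _]mulrC mulfK ?gt_eqF //.
have rot_u n := rot_uniq n [:: a; b; c; d].
have qcc : dotp (q c) (q c) = rho by rewrite qc dotpNl dotpNr opprK.
have qdd : dotp (q d) (q d) = rho by rewrite qd dotpNl dotpNr opprK qb.
have := mem_uniq4 k u; rewrite !inE => /or4P[] /eqP->.
- by apply: (force_at_vertex u).
- apply: (@force_at_vertex _ _ _ _ _ b c d a) => //; rewrite ?(rot_u 1%N) //.
  + by rewrite qc dotpNr dotpC qab oppr0.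
  + by rewrite qc opprK.
- apply: (@force_at_vertex _ _ _ _ _ c d a b) => //; rewrite ?(rot_u 2%N) //.
  + by rewrite qc qd dotpNr dotpNl opprK.
  + by rewrite qc opprK.
  + by rewrite qd opprK.
apply: (@force_at_vertex _ _ _ _ _ d a b c) => //; rewrite ?(rot_u 3%N) //.
  by rewrite qd dotpNl dotpC qab oppr0.
by rewrite qd opprK.
Qed.

End CentralSquares.

Theorem corollary3p6 (R : realType) (alpha : R) (m : 'I_4 -> R)
    (x : 'I_4 -> 'rV[R]_3)
    (alpha_gt0 : 0 < alpha)
    (m_gt0 : forall k, 0 < m k)
    (x_inj : injective x)
    (x_circ : centered_cocircular m x) :
  central_configuration alpha m x <->
  (forall i j, m i = m j) /\ square_in_some_order x.
Proof.
split=> [|[m_eq x_square]]; first exact: square_of_central.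
exact: central_of_square.
Qed.
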